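(* Let $x_1,\ldots,x_m\in\mathbb{R}^n$, let $X=[x_1,\ldots,x_m]$, and let $u\in\mathbb{R}^m$ satisfy $u\ge 0$, $e^Tu=1$ and $XUX^T$ positive definite, where $U=\mathrm{diag}(u)$. For $v\in\mathbb{R}^m$ with $XVX^T$ nonsingular ($V=\mathrm{diag}(v)$) put $\kappa(v)_i=x_i^T(XVX^T)^{-1}x_i$, $i=1,\ldots,m$. Then for every $i\in\{1,\ldots,m\}$ (with $x_i\neq 0$): (a) for all $\theta_i\ge 0$, $|\kappa(u+\theta_i e_i)_i-\kappa(u)_i|\le (\kappa(u)_i)^2\,|\theta_i|$; (b) if $\kappa(u)_i\le n$, then for all $\theta_i$ with $\frac{\kappa(u)_i-n}{\kappa(u)_i\,n}\le\theta_i\le 0$, $|\kappa(u+\theta_i e_i)_i-\kappa(u)_i|\le n\,\kappa(u)_i\,|\theta_i|$.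
   Context: $e$ is the all-ones vector and $e_i$ the $i$-th standard basis vector of $\mathbb{R}^m$. The vector $u$ is a feasible point of the dual minimum volume enclosing ellipsoid problem $(D_2)$: minimize $g(u)=-\ln\det(XUX^T)$ over the simplex $\triangle_m=\{u\ge 0: e^Tu=1\}$. The numbers $\kappa(u)_i$ are, up to sign, the partial derivatives of $g$. *)

(* Defs.v *)
From HB Require Import structures.
From mathcomp Require Import all_boot all_order all_algebra.
From mathcomp Require Import reals.

Set Implicit Arguments.
Unset Strict Implicit.
Unset Printing Implicit Defensive.

Import Order.TTheory GRing.Theory Num.Theory.
Local Open Scope ring_scope.

Definition posdefmx (R : realType) (n : nat) (A : 'M[R]_n) : Prop :=
  A^T = A /\ forall y : 'cV[R]_n, y != 0 -> 0 < (y^T *m A *m y) 0 0.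

(* X V X^T with V = diag(v). The weights are a row vector because [diag_mx]
   takes one; the points x_i in R^n are the columns of X. *)
Definition scattermx (R : realType) (n m : nat) (X : 'M[R]_(n, m)) (v : 'rV[R]_m)
  : 'M[R]_n := X *m diag_mx v *m X^T.

(* Meaningful only when [scattermx X v] is nonsingular: [invmx] is the identity on
   singular matrices. *)
Definition kappa (R : realType) (n m : nat) (X : 'M[R]_(n, m)) (v : 'rV[R]_m)
  (i : 'I_m) : R := ((col i X)^T *m invmx (scattermx X v) *m col i X) 0 0.

Definition shift (R : realType) (m : nat) (u : 'rV[R]_m) (i : 'I_m) (theta : R)
  : 'rV[R]_m := u + theta *: delta_mx 0 i.

(* Main.v *)
Require Import Defs.
From mathcomp Require Import all_boot all_order all_algebra.
From mathcomp Require Import reals.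
From mathcomp Require Import ring.
Import Order.TTheory GRing.Theory Num.Theory.
Local Open Scope ring_scope.

(** Write [A] for [X U X^T], [x] for the [i]-th column of [X] and [k] for
    [x^T A^-1 x]. Moving the [i]-th weight by [theta] adds the rank-one matrix
    [theta x x^T] to [A], so the Sherman-Morrison formula ([sherman_morrison])
    gives the new value [k / (1 + theta k)] exactly, as soon as
    [1 + theta k != 0]. The variation is therefore [k^2 |theta|] divided by
    [1 + theta k], and each estimate amounts to a lower bound on that
    denominator: it is at least [1] if [theta >= 0], and at least [k / n] on the
    range of part (b), whose left end is [1/n - 1/k]. Positive definiteness
    gives [k > 0] ([posdefmx_inv_gt0]), so both bounds are positive, and in
    particular the new matrix is nonsingular. *)

(** A null vector of [A] would also annihilate the quadratic form. *)
Lemma posdefmx_unit {R : realType} {n : nat} {A : 'M[R]_n} :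
  posdefmx A -> A \in unitmx.
Proof.
move=> [_ A_pos]; rewrite unitmxE unitfE; apply/negP => /det0P [v v_neq0 vA0].
have := A_pos v^T; rewrite trmxK vA0 mul0mx mxE ltxx trmx_eq0.
by move=> /(_ v_neq0).
Qed.

(** The inverse form at [x] is the form of [A] at [A^-1 x]. *)
Lemma posdefmx_inv_gt0 {R : realType} {n : nat} {A : 'M[R]_n} {x : 'cV[R]_n} :
  posdefmx A -> x != 0 -> 0 < (x^T *m invmx A *m x) 0 0.
Proof.
move=> A_pd x_neq0; have A_unit := posdefmx_unit A_pd.
have [A_sym A_pos] := A_pd.
have : invmx A *m x != 0.
  apply: contraNneq x_neq0 => Vx0.
  by rewrite -(mulKVmx A_unit x) Vx0 mulmx0.
by move/A_pos; rewrite trmx_mul trmx_inv A_sym -(mulmxA _ A) mulKVmx.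
Qed.

(** The inverse is again a rank-one correction: multiplying out, the quadratic
    term [x y A^-1 x y A^-1] collapses to [k x y A^-1], so only one scalar
    equation is left for the coefficient of the correction. *)
Lemma sherman_morrison {F : fieldType} {n : nat} {A : 'M[F]_n} {x : 'cV[F]_n}
    {y : 'rV[F]_n} {theta : F} (k := (y *m invmx A *m x) 0 0) :
  A \in unitmx -> 1 + theta * k != 0 ->
  A + theta *: (x *m y) \in unitmx /\
  invmx (A + theta *: (x *m y)) =
    invmx A - theta / (1 + theta * k) *: (invmx A *m x *m (y *m invmx A)).
Proof.
move=> A_unit d_neq0; set c := theta / _; set B := _ + _; set C := _ - _.
have BC1 : B *m C = 1%:M.
  have yVx : y *m invmx A *m x = k%:M by rewrite [LHS]mx11_scalar.
  rewrite /B /C mulmxBr !mulmxDl mulmxV // -!scalemxAr -!scalemxAl.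
  rewrite -[invmx A *m x *m _]mulmxA mulKVmx //.
  have -> : x *m y *m (invmx A *m (x *m (y *m invmx A)))
            = k *: (x *m (y *m invmx A)).
    rewrite -[x *m y *m _]mulmxA (mulmxA y) (mulmxA (y *m _)) yVx.
    by rewrite mul_scalar_mx -scalemxAr.
  rewrite -(mulmxA x y) !scalerA -scalerDl -addrA -scalerBl.
  have -> : theta - (c + c * theta * k) = 0 by rewrite /c; field.
  by rewrite scale0r addr0.
have [B_unit _] := mulmx1_unit BC1; split => //.
by rewrite -[LHS]mulmx1 -BC1 mulKmx.
Qed.

Lemma scattermx_shift (R : realType) (n m : nat) (X : 'M[R]_(n, m))
    (u : 'rV[R]_m) (i : 'I_m) (theta : R) :
  scattermx X (shift u i theta)
    = scattermx X u + theta *: (col i X *m (col i X)^T).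
Proof.
rewrite /scattermx /shift linearD linearZ /= mulmxDr mulmxDl.
congr (_ + _); rewrite -scalemxAr -scalemxAl; congr (_ *: _).
have -> : diag_mx (delta_mx 0 i) =
    delta_mx i (0 : 'I_1) *m delta_mx 0 i :> 'M[R]_m.
  apply/matrixP => a b; rewrite mul_delta_mx !mxE /=.
  by case: (eqVneq a b) => [<-|]; case: (eqVneq a i) => //= ->;
     case: eqVneq => // ->; rewrite eqxx.
rewrite mulmxA -(mulmxA (X *m _)) -colE; congr (_ *m _).
by rewrite colE trmx_mul trmx_delta.
Qed.

Lemma kappa_shift {R : realType} {n m : nat} {X : 'M[R]_(n, m)} {u : 'rV[R]_m}
    {i : 'I_m} {theta : R} :
  scattermx X u \in unitmx -> 1 + theta * kappa X u i != 0 ->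
  scattermx X (shift u i theta) \in unitmx /\
  kappa X (shift u i theta) i = kappa X u i / (1 + theta * kappa X u i).
Proof.
move=> A_unit d_neq0.
have [B_unit B_inv] := sherman_morrison A_unit d_neq0.
rewrite [kappa X (shift u i theta) i]/kappa scattermx_shift; split=> //.
rewrite B_inv -/(kappa X u i) mulmxBr mulmxBl -scalemxAr -scalemxAl !mulmxA.
set x := col i X; set V := invmx _.
have xVx : x^T *m V *m x = (kappa X u i)%:M by rewrite [LHS]mx11_scalar.
rewrite xVx mul_scalar_mx -!scalemxAl xVx !mxE eqxx !mulr1n.
by field.
Qed.

(** The variation is [k^2 |theta| / (1 + theta k)], so a lower bound [d] on the
    denominator gives both nonsingularity and an estimate. *)
Lemma kappa_shift_bound {R : realType} {n m : nat} {X : 'M[R]_(n, m)}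
    {u : 'rV[R]_m} {i : 'I_m} {theta d : R} :
  scattermx X u \in unitmx -> 0 < d -> d <= 1 + theta * kappa X u i ->
  scattermx X (shift u i theta) \in unitmx /\
  `|kappa X (shift u i theta) i - kappa X u i|
    <= kappa X u i ^+ 2 / d * `|theta|.
Proof.
move=> A_unit d_gt0 d_le; have e_gt0 := lt_le_trans d_gt0 d_le.
have e_neq0 := lt0r_neq0 e_gt0.
have [B_unit ->] := kappa_shift A_unit e_neq0; split=> //.
set k := kappa X u i in d_le e_gt0 e_neq0 *.
have -> : k / (1 + theta * k) - k = - (k ^+ 2 / (1 + theta * k) * theta).
  by field.
rewrite normrN normrM ler_wpM2r // ger0_norm; last first.
  by rewrite divr_ge0 ?sqr_ge0 // ltW.
by rewrite ler_wpM2l ?sqr_ge0 // lef_pV2.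
Qed.

Theorem lemma1 (R : realType) (n m : nat) (X : 'M[R]_(n, m)) (u : 'rV[R]_m)
    (u_ge0 : forall j : 'I_m, 0 <= u 0 j)
    (u_sum1 : \sum_(j < m) u 0 j = 1)
    (XUX_pd : posdefmx (scattermx X u))
    (i : 'I_m) (xi_neq0 : col i X != 0) :
  (forall theta : R, 0 <= theta ->
     scattermx X (shift u i theta) \in unitmx /\
     `|kappa X (shift u i theta) i - kappa X u i|
       <= kappa X u i ^+ 2 * `|theta|)
  /\
  (kappa X u i <= n%:R ->
   forall theta : R,
     (kappa X u i - n%:R) / (kappa X u i * n%:R) <= theta <= 0 ->
     scattermx X (shift u i theta) \in unitmx /\
     `|kappa X (shift u i theta) i - kappa X u i|
       <= n%:R * kappa X u i * `|theta|).
Proof.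
have A_unit := posdefmx_unit XUX_pd.
have k_gt0 : 0 < kappa X u i := posdefmx_inv_gt0 XUX_pd xi_neq0.
split=> [theta theta_ge0 | k_le_n theta /andP[theta_ge _]].
  rewrite -[_ ^+ 2]divr1; apply: kappa_shift_bound => //.
  by rewrite lerDl mulr_ge0 // ltW.
have n_gt0 := lt_le_trans k_gt0 k_le_n.
have k_neq0 := lt0r_neq0 k_gt0; have n_neq0 := lt0r_neq0 n_gt0.
have -> : n%:R * kappa X u i = kappa X u i ^+ 2 / (kappa X u i / n%:R).
  by field; rewrite k_neq0 n_neq0.
apply: kappa_shift_bound => //; first exact: divr_gt0.
have -> : kappa X u i / n%:R
    = 1 + (kappa X u i - n%:R) / (kappa X u i * n%:R) * kappa X u i.
  by field; rewrite k_neq0 n_neq0.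
by rewrite lerD2l ler_wpM2r // ltW.
Qed.
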